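(* Let $F$ be a field and let $Q$ and $R$ be two spaces of quantities over $F$, both free of zero divisors. Then $Q$ and $R$ are isomorphic as spaces of quantities if and only if $\operatorname{rank}(Q)=\operatorname{rank}(R)$.
   Context: A group of dimensions is a finitely generated free Abelian group $\mathcal{D}$, written multiplicatively with identity $1_{\mathcal{D}}$. A space of quantities with group of dimensions $\mathcal{D}$ over a field $F$ is a set $Q$ together with a surjective map $\dim:Q\to\mathcal{D}$ such that: (i) for each $A\in\mathcal{D}$ the fiber $\dim^{-1}(A)$ has the structure of a one-dimensional vector space over $F$; (ii) there is a product on $Q$ making it an Abelian monoid (identity $1_Q$), and $\dim$ is a monoid homomorphism, $\dim(qr)=\dim(q)\dim(r)$; (iii) $q(r_1+r_2)=qr_1+qr_2$ whenever $q,r_1,r_2\in Q$ with $\dim(r_1)=\dim(r_2)$, and $\alpha(qr)=(\alpha q)r$ for $q,r\in Q$, $\alpha\in F$. The rank of $Q$, $\operatorname{rank}(Q)$, is the rank of its group of dimensions as a free Abelian group. A zero of $Q$ is the zero vector of some fiber (each fiber has its own zero); an element is nonzero if it is not a zero. $Q$ is free of zero divisors if there are no nonzero $q,r\in Q$ such that $qr$ is a zero. A homomorphism of spaces of quantities $\psi:Q\to R$ (both over $F$) is a map such that (i) $\psi(q_1q_2)=\psi(q_1)\psi(q_2)$ for all $q_1,q_2\in Q$; and (ii) if $q_1,q_2$ are in the same fiber of $Q$, then $\psi(q_1),\psi(q_2)$ are in the same fiber of $R$ and $\psi(\alpha q_1+\beta q_2)=\alpha\psi(q_1)+\beta\psi(q_2)$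 for all $\alpha,\beta\in F$. An isomorphism is a bijective homomorphism; $Q$ and $R$ are isomorphic if an isomorphism $Q\to R$ exists. *)

(* Defs.v *)
From HB Require Import structures.
From mathcomp Require Import all_boot all_algebra.
From mathcomp Require Import boolp.

Set Implicit Arguments.
Unset Strict Implicit.
Unset Printing Implicit Defensive.

Import GRing.Theory.
Local Open Scope ring_scope.

(* An Abelian group is a zmodType, so the group of dimensions is written
   additively: 0 is the identity and A + B the product of two dimensions. *)
Definition is_Zbasis (D : zmodType) (n : nat) (e : 'I_n -> D) : Prop :=
  forall A : D, exists! z : {ffun 'I_n -> int}, A = \sum_(i < n) e i *~ z i.

Record dimGroup := DimGroup {
  dim_zmod :> zmodType;
  dim_free : exists n : nat, exists e : 'I_n -> dim_zmod, is_Zbasis e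
}.

(* The size of some Z-basis; all Z-bases of D have the same size. *)
Definition free_rank (D : dimGroup) : nat := sval (cid (dim_free D)).

Definition one_dimensional (F : fieldType) (V : lmodType F) : Prop :=
  exists e : V, forall v : V, exists! a : F, v = a *: e.

(* The library's [monoidType] is not commutative, hence [qmulC].
   Only the laws are listed here that do not relate the product to the vector space
   structures: the others need the product to be seen as a map between fibers. *)
Record preQuantities (F : fieldType) (D : dimGroup) := PreQuantities {
  qcarrier :> monoidType;
  qmulC : forall q r : qcarrier, (q * r)%g = (r * q)%g;
  dim : qcarrier -> D;
  dim_surj : forall A : D, exists q : qcarrier, dim q = A;
  dim1 : dim 1%g = 0;
  dimM : forall q r : qcarrier, dim (q * r)%g = dim q + dim r;
  fiber_class : forall A : D, GRing.Lmodule F {q : qcarrier | dim q == A}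
}.

Section Fibers.
Variables (F : fieldType) (D : dimGroup) (Q : preQuantities F D).

Definition fiber (A : D) : lmodType F := GRing.Lmodule.Pack (fiber_class Q A).

Definition qval (A : D) (x : fiber A) : Q := sval x.

Lemma dim_qval (A : D) (x : fiber A) : dim (qval x) = A.
Proof. exact/eqP/(svalP x). Qed.

Lemma fmul_subproof (A B : D) (x : fiber A) (y : fiber B) :
  dim (qval x * qval y)%g == A + B.
Proof. by rewrite dimM !dim_qval. Qed.

Definition fmul (A B : D) (x : fiber A) (y : fiber B) : fiber (A + B) :=
  exist _ (qval x * qval y)%g (fmul_subproof x y).

End Fibers.

Record quantities (F : fieldType) (D : dimGroup) := Quantities {
  qbase :> preQuantities F D;
  fiber_dim1 : forall A : D, one_dimensional (fiber qbase A);
  fmulDr : forall (A B : D) (q : fiber qbase A) (r1 r2 : fiber qbase B),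
    fmul q (r1 + r2) = fmul q r1 + fmul q r2;
  fmulZl : forall (A B : D) (a : F) (q : fiber qbase A) (r : fiber qbase B),
    a *: fmul q r = fmul (a *: q) r
}.

Definition qrank (F : fieldType) (D : dimGroup) (Q : quantities F D) : nat :=
  free_rank D.

Definition is_qzero (F : fieldType) (D : dimGroup) (Q : quantities F D)
    (q : Q) : Prop :=
  exists A : D, q = qval (0 : fiber Q A).

Definition zero_divisor_free (F : fieldType) (D : dimGroup)
    (Q : quantities F D) : Prop :=
  ~ exists q r : Q, [/\ ~ is_qzero q, ~ is_qzero r & is_qzero (q * r)%g].

Definition is_qhom (F : fieldType) (D E : dimGroup)
    (Q : quantities F D) (R : quantities F E) (psi : Q -> R) : Prop :=
  (forall q1 q2 : Q, psi (q1 * q2)%g = (psi q1 * psi q2)%g) /\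
  (forall (A : D) (q1 q2 : fiber Q A),
     exists (B : E) (r1 r2 : fiber R B),
       [/\ psi (qval q1) = qval r1,
           psi (qval q2) = qval r2 &
           forall a b : F,
             psi (qval (a *: q1 + b *: q2)) = qval (a *: r1 + b *: r2)]).

Definition qisomorphic (F : fieldType) (D E : dimGroup)
    (Q : quantities F D) (R : quantities F E) : Prop :=
  exists psi : Q -> R, is_qhom psi /\ bijective psi.

(* Main.v *)
From HB Require Import structures.
From mathcomp Require Import all_boot all_algebra.
From mathcomp Require Import boolp.
Require Import Defs.

(** An isomorphism maps the zero of each fiber to a zero, so it induces an
    additive bijection between the groups of dimensions, which therefore have
    the same rank.  Conversely, without zero divisors every nonzero quantity is
    invertible, so sending a basis of the group of dimensions to nonzero
    quantities extends to a multiplicative section of [dim].  The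
    section is a basis of every fiber, compatible with products; two spaces
    whose groups of dimensions are isomorphic are identified coordinatewise. *)

Set Implicit Arguments.
Unset Strict Implicit.
Unset Printing Implicit Defensive.

Import GRing.Theory.
Local Open Scope ring_scope.

(** * The Abelian group of units of a commutative monoid *)

Section CommutativeMonoidUnits.
Variables (M : monoidType) (mulC : forall x y : M, (x * y)%g = (y * x)%g).

(* Written additively, to have integer multiples and commutative sums; the
   commutativity proof is a parameter so that the zmodType instance finds it. *)
Definition munit (_ : forall x y : M, (x * y)%g = (y * x)%g) :=
  {x : M | `[< exists y : M, (x * y)%g = 1%g >]}.

Local Notation U := (munit mulC).

HB.instance Definition _ := Choice.on U.

Definition mk_munit (x y : M) (xy : (x * y)%g = 1%g) : U :=
  exist _ x (introT (asboolP _) (ex_intro _ y xy)).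

Definition munit_inv (x : U) : M := sval (cid (elimT (asboolP _) (svalP x))).

Lemma munit_mulV (x : U) : (sval x * munit_inv x)%g = 1%g.
Proof. by rewrite /munit_inv; case: cid. Qed.

Lemma munit_mulVl (x : U) : (munit_inv x * sval x)%g = 1%g.
Proof. by rewrite mulC munit_mulV. Qed.

Lemma munit_mulM (x y : U) :
  ((sval x * sval y) * (munit_inv y * munit_inv x))%g = 1%g.
Proof. by rewrite mulgA -(mulgA (sval x)) munit_mulV mulg1 munit_mulV. Qed.

Definition munit0 : U := mk_munit (mulg1 1%g).
Definition munit_opp (x : U) : U := mk_munit (munit_mulVl x).
Definition munit_add (x y : U) : U := mk_munit (munit_mulM x y).

Fact munit_addA : associative munit_add.
Proof. by move=> x y z; apply: val_inj; rewrite /= mulgA. Qed.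

Fact munit_addC : commutative munit_add.
Proof. by move=> x y; apply: val_inj; rewrite /= mulC. Qed.

Fact munit_add0 : left_id munit0 munit_add.
Proof. by move=> x; apply: val_inj; rewrite /= mul1g. Qed.

Fact munit_addN : left_inverse munit0 munit_opp munit_add.
Proof. by move=> x; apply: val_inj; rewrite /= munit_mulVl. Qed.

HB.instance Definition _ :=
  GRing.isZmodule.Build U munit_addA munit_addC munit_add0 munit_addN.

End CommutativeMonoidUnits.

(** * Linear algebra over the integers: bases, extension and rank *)

Lemma Zbasis_ext (D V : zmodType) (n : nat) (e : 'I_n -> D) (u : 'I_n -> V) :
  is_Zbasis e ->
  exists h : {additive D -> V}, forall i, h (e i) = u i.
Proof.
move=> eb; pose c A := sval (cid (eb A)).
have cE A : A = \sum_i e i *~ c A i by have [] := svalP (cid (eb A)).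
have cU A (z : {ffun 'I_n -> int}) : A = \sum_i e i *~ z i -> c A = z.
  by have [_ h] := svalP (cid (eb A)); apply: h.
pose h A := \sum_i u i *~ c A i.
have hB : zmod_morphism h.
  (* By uniqueness, the coordinates of a difference are the differences of the coordinates. *)
  move=> A B; rewrite /h (cU _ [ffun i => c A i - c B i]).
    by rewrite -sumrB; apply: eq_bigr => i _; rewrite ffunE mulrzBr.
  rewrite {1}[A]cE {1}[B]cE -sumrB.
  by apply: eq_bigr => i _; rewrite ffunE mulrzBr.
pose hM := GRing.isZmodMorphism.Build _ _ h hB.
pose hA : {additive D -> V} := HB.pack h hM.
exists hA => j; rewrite /= /h.
rewrite (cU (e j) [ffun i => (i == j)%:Z]); last first.
  rewrite (bigD1 j) //= ffunE eqxx mulr1z big1 ?addr0 // => i /negPf ij.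
  by rewrite ffunE ij.
rewrite (bigD1 j) //= ffunE eqxx mulr1z big1 ?addr0 // => i /negPf ij.
by rewrite ffunE ij.
Qed.

Lemma Zbasis_sum (D : zmodType) (n : nat) (e : 'I_n -> D) (A : D) :
  is_Zbasis e -> exists z : 'I_n -> int, A = \sum_i e i *~ z i.
Proof. by move=> /(_ A)[z [-> _]]; exists z. Qed.

Lemma Zbasis_additive_ext (D V : zmodType) (n : nat) (e : 'I_n -> D)
    (g h : {additive D -> V}) :
  is_Zbasis e -> (forall i, g (e i) = h (e i)) -> g =1 h.
Proof.
move=> eb gh A; have [z ->] := Zbasis_sum A eb.
by rewrite !raddf_sum; apply: eq_bigr => i _; rewrite !raddfMz gh.
Qed.

Lemma Zbasis_surj_leq (D E : zmodType) (n m : nat)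
    (e : 'I_n -> D) (f : 'I_m -> E) (h : {additive D -> E}) :
  is_Zbasis e -> is_Zbasis f -> (forall B, exists A, h A = B) -> (m <= n)%N.
Proof.
move=> eb fb hs.
have [d hd] := choice (fun j => hs (f j)).
have [z zE] := choice (fun j => Zbasis_sum (d j) eb).
have [w wE] := choice (fun i => Zbasis_sum (h (e i)) fb).
(* The matrix of [h] has a left inverse: the coordinates of the preimages [d]. *)
apply: (@mulmx1_min _ m n (\matrix_(j, i) z j i) (\matrix_(i, k) w i k)).
apply/matrixP => j k.
have [z0 [_ zu]] := fb (f j).
(* Row [j] of the matrix product and row [j] of the identity are both coordinates of [f j], hence
   equal. *)
pose z1 := [ffun k => \sum_i z j i * w i k].
pose z2 := [ffun k => (j == k)%:Z].
have: z1 = z2.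
  rewrite -(zu z1) ?(zu z2) //.
    rewrite (bigD1 j) //= ffunE eqxx mulr1z big1 ?addr0 // => i /negPf ij.
    by rewrite ffunE eq_sym ij.
  rewrite -{1}hd zE raddf_sum.
  under eq_bigr => i _ do rewrite raddfMz wE mulrz_suml.
  rewrite exchange_big; apply: eq_bigr => l _ /=.
  rewrite ffunE mulrz_sumr; apply: eq_bigr => i _.
  by rewrite -mulrzA mulrC.
move/ffunP/(_ k); rewrite !ffunE !mxE natz => <-.
by apply: eq_bigr => i _; rewrite !mxE.
Qed.

(** * Zeros, invertible quantities and the section of [dim] *)

Section Fibers.
Variables (F : fieldType) (D : dimGroup) (Q : quantities F D).
Implicit Types (A B : D).

Lemma qval_inj A : injective (@qval F D Q A).
Proof. exact: val_inj. Qed.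

Definition in_fiber (q : Q) : fiber Q (dim q) := exist _ q (eqxx (dim q)).

(** Comparing in [Q] avoids casts between fibers such as those over [A + B] and [B + A], which are
    distinct types. *)
Lemma qval_scale_eq A B (x : fiber Q A) (y : fiber Q B) (a : F) :
  qval x = qval y -> qval (a *: x) = qval (a *: y).
Proof.
move=> xy; have AB : A = B by rewrite -(dim_qval x) xy dim_qval.
by case: B / AB y xy => y /qval_inj ->.
Qed.

Lemma is_qzeroP A (x : fiber Q A) : is_qzero (qval x) <-> x = 0.
Proof.
split=> [[B xB]|->]; last by exists A.
have AB : A = B by rewrite -(dim_qval x) xB dim_qval.
by case: B / AB xB => /qval_inj.
Qed.

(** The axiom moves scalars out of the left factor only; commutativity gives the right one. *)
Lemma qval_mulZ A B (x : fiber Q A) (y : fiber Q B) (a b : F) :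
  (qval (a *: x) * qval (b *: y))%g = qval ((a * b) *: fmul x y).
Proof.
rewrite -scalerA -[LHS]/(qval (fmul (a *: x) (b *: y))) -fmulZl.
apply: qval_scale_eq.
transitivity (qval (b *: fmul y x)); first by rewrite fmulZl; exact: qmulC.
by apply: qval_scale_eq; exact: qmulC.
Qed.

Lemma qval_mul0 A B (x : fiber Q A) :
  (qval x * qval (0 : fiber Q B))%g = qval (0 : fiber Q (A + B)).
Proof. by rewrite -(scale0r 0) -{1}(scale1r x) qval_mulZ mulr0 scale0r. Qed.

Lemma one_dimensional_nz (V : lmodType F) (x : V) :
  one_dimensional V -> x != 0 -> forall v, exists a, v = a *: x.
Proof.
move=> [e eP] x0 v.
have [a [xE _]] := eP x; have [b [-> _]] := eP v.
have a0 : a != 0 by apply: contraNneq x0 => a0; rewrite xE a0 scale0r.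
by exists (b / a); rewrite xE scalerA divfK.
Qed.

Lemma fiber_nz A : exists x : fiber Q A, x != 0.
Proof.
have [e eP] := fiber_dim1 Q A; exists e; apply/eqP => e0.
(* If the generator [e] were zero, both [0] and [1] would be coordinates of the zero vector. *)
have [a [_ aU]] := eP 0.
have a0 : a = 0 by apply: aU; rewrite scale0r.
have /eqP : a = 1 by apply: aU; rewrite e0 scaler0.
by rewrite a0 eq_sym oner_eq0.
Qed.

Definition fiber_one : fiber Q 0 := exist _ 1%g (introT eqP (dim1 Q)).

(** Otherwise every [x] of dimension [0], being [x * 1], would be a zero, against [fiber_nz]. *)
Lemma fiber_one_nz : fiber_one != 0.
Proof.
apply/eqP => one0; have [x /eqP[]] := fiber_nz 0.
apply/is_qzeroP; exists (0 + 0).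
by rewrite -(qval_mul0 0 x) -one0 mulg1.
Qed.

Lemma qunit_nz A (x : fiber Q A) (r : Q) : (qval x * r)%g = 1%g -> x != 0.
Proof.
move=> xr; apply/eqP => x0.
have /eqP[] := fiber_one_nz; apply/is_qzeroP.
exists (dim r + A); rewrite -(qval_mul0 _ (in_fiber r)) -x0.
by rewrite qmulC xr.
Qed.

Hypothesis hQ : zero_divisor_free Q.

(** Multiplying [x] by a nonzero [y] of opposite dimension gives a nonzero element of the fiber of
    [1]. That fiber is a line, so [1] is a multiple of the product, and rescaling [y] gives the
    inverse. *)
Lemma nz_invertible A (x : fiber Q A) :
  x != 0 -> exists r : Q, (qval x * r)%g = 1%g.
Proof.
move=> x0; have [y y0] := fiber_nz (- A).
have dxy : dim (qval x * qval y)%g = 0 by rewrite dimM !dim_qval subrr.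
pose z : fiber Q 0 := exist _ (qval x * qval y)%g (introT eqP dxy).
have z0 : z != 0.
  apply/eqP => /is_qzeroP xy; apply: hQ; exists (qval x), (qval y).
  by split=> // /is_qzeroP; apply/eqP.
have [a aE] := one_dimensional_nz (fiber_dim1 Q 0) z0 fiber_one.
exists (qval (a *: y)); rewrite -(scale1r x) qval_mulZ mul1r.
by rewrite (_ : 1%g = qval fiber_one) // aE; apply: qval_scale_eq.
Qed.

(** Nonzero representatives of a basis are units, and units form an Abelian group, so [Zbasis_ext]
    extends the choice to a homomorphism [h] into the units. *)
Lemma dim_section :
  exists s : forall A, fiber Q A,
    (forall A B, fmul (s A) (s B) = s (A + B)) /\ forall A, s A != 0.
Proof.
have [n [e eb]] := dim_free D.
pose u i := sval (cid (fiber_nz (e i))).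
have u0 i : u i != 0 := svalP (cid (fiber_nz (e i))).
have [v uv] := choice (fun i => nz_invertible (u0 i)).
pose mulC := @qmulC F D Q; pose U := munit mulC.
have [h hE] := Zbasis_ext (fun i => mk_munit mulC (uv i)) eb.
pose d (x : U) : D := dim (sval x).
have dN : nmod_morphism d by split=> [|x y]; [exact: dim1 | exact: dimM].
pose dM := GRing.isNmodMorphism.Build _ _ d dN.
pose dA : {additive U -> D} := HB.pack d dM.
(* The composite of [dim] with [h] is additive and fixes the basis, so it is the identity. *)
have dh A : dim (sval (h A)) = A.
  have := @Zbasis_additive_ext _ _ _ _ (dA \o h) idfun eb _ A.
  by apply=> i /=; rewrite hE /d /= dim_qval.
pose s A : fiber Q A := exist _ (sval (h A)) (introT eqP (dh A)).
exists s; split=> [A B|A].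
  by apply: qval_inj; rewrite /= raddfD.
by apply: (@qunit_nz _ _ (munit_inv (h A))); exact: munit_mulV.
Qed.

End Fibers.

(** * Maps defined by coordinates along multiplicative sections *)

Section Transport.
Variables (F : fieldType) (D E : dimGroup).
Variables (Q : quantities F D) (R : quantities F E).
Variables (s : forall A, fiber Q A) (t : forall B, fiber R B).
Hypotheses (sM : forall A B, fmul (s A) (s B) = s (A + B)).
Hypotheses (tM : forall A B, fmul (t A) (t B) = t (A + B)).
Hypothesis s0 : forall A, s A != 0.

Lemma qval_coord (q : Q) : exists a, q = qval (a *: s (dim q)).
Proof.
have [a aE] := one_dimensional_nz (fiber_dim1 Q _) (s0 (dim q)) (in_fiber q).
by exists a; rewrite -aE.
Qed.

Lemma coord_inj A (a b : F) : a *: s A = b *: s A -> a = b.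
Proof.
move=> /eqP; rewrite -subr_eq0 -scalerBl scaler_eq0 (negPf (s0 A)) orbF.
by rewrite subr_eq0 => /eqP.
Qed.

Lemma coord_map (phi : D -> E) :
  exists psi : Q -> R, forall A a, psi (qval (a *: s A)) = qval (a *: t (phi A)).
Proof.
have [c cE] := choice qval_coord.
exists (fun q => qval (c q *: t (phi (dim q)))) => A a.
set q := qval (a *: s A); have dq : dim q = A by rewrite dim_qval.
by have := cE q; rewrite dq => /qval_inj/coord_inj <-.
Qed.

(** A product of quantities multiplies the coordinates and adds the dimensions, in [Q] as in [R];
    within one fiber only the coordinate varies, and it is kept. *)
Lemma coord_map_hom (phi : {additive D -> E}) (psi : Q -> R) :
  (forall A a, psi (qval (a *: s A)) = qval (a *: t (phi A))) -> is_qhom psi.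
Proof.
move=> psiE; split=> [q r|A q r].
  have [a ->] := qval_coord q; have [b ->] := qval_coord r.
  by rewrite qval_mulZ sM !psiE qval_mulZ tM raddfD.
have [a ->] := one_dimensional_nz (fiber_dim1 Q A) (s0 A) q.
have [b ->] := one_dimensional_nz (fiber_dim1 Q A) (s0 A) r.
exists (phi A), (a *: t (phi A)), (b *: t (phi A)); split=> // k l.
by rewrite !scalerA -!scalerDl psiE.
Qed.

End Transport.

Lemma coord_map_cancel (F : fieldType) (D E : dimGroup)
    (Q : quantities F D) (R : quantities F E)
    (s : forall A, fiber Q A) (t : forall B, fiber R B)
    (phi : D -> E) (phi' : E -> D) (psi : Q -> R) (psi' : R -> Q) :
  (forall A, s A != 0) -> cancel phi phi' ->
  (forall A a, psi (qval (a *: s A)) = qval (a *: t (phi A))) ->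
  (forall B a, psi' (qval (a *: t B)) = qval (a *: s (phi' B))) ->
  cancel psi psi'.
Proof.
move=> s0 phiK psiE psiE' q; have [a ->] := qval_coord s0 q.
by rewrite psiE psiE' phiK.
Qed.

(** * Isomorphisms of groups of dimensions and equality of ranks *)

Lemma dimGroup_iso (D E : dimGroup) : free_rank D = free_rank E ->
  exists (phi : {additive D -> E}) (phi' : {additive E -> D}),
    cancel phi phi' /\ cancel phi' phi.
Proof.
rewrite /free_rank; case: cid => n [e eb]; case: cid => m [f fb] /= nm.
case: m / nm f fb => f fb.
have [phi phiE] := Zbasis_ext f eb; have [phi' phiE'] := Zbasis_ext e fb.
exists phi, phi'; split=> A.
  have := @Zbasis_additive_ext _ _ _ _ (phi' \o phi) idfun eb _ A.
  by apply=> i /=; rewrite phiE.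
have := @Zbasis_additive_ext _ _ _ _ (phi \o phi') idfun fb _ A.
by apply=> i /=; rewrite phiE'.
Qed.

Lemma free_rank_leq (D E : dimGroup) (h : {additive D -> E}) :
  (forall B, exists A, h A = B) -> (free_rank E <= free_rank D)%N.
Proof.
rewrite /free_rank; case: cid => m [f fb]; case: cid => n [e eb] /=.
exact: Zbasis_surj_leq eb fb.
Qed.

Lemma additive_bij_free_rank (D E : dimGroup) (h : {additive D -> E}) :
  bijective h -> free_rank D = free_rank E.
Proof.
move=> [g hK gK]; apply/eqP; rewrite eqn_leq.
have gB : zmod_morphism g by move=> A B; apply: (can_inj hK); rewrite raddfB !gK.
pose gM := GRing.isZmodMorphism.Build _ _ g gB.
pose gA : {additive E -> D} := HB.pack g gM.
by rewrite (@free_rank_leq _ _ gA) ?(@free_rank_leq _ _ h) // => A;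
  [exists (g A) | exists (h A)].
Qed.

(** * The map of dimensions induced by an isomorphism *)

Section Isomorphism.
Variables (F : fieldType) (D E : dimGroup).
Variables (Q : quantities F D) (R : quantities F E) (psi : Q -> R).
Hypotheses (psiH : is_qhom psi) (psiB : bijective psi).

(** The zero serves as a canonical element of the fiber; by [dim_qhom] any other gives the same
    dimension. *)
Let phi (A : D) : E := dim (psi (qval (0 : fiber Q A))).

Lemma dim_qhom A (x : fiber Q A) : dim (psi (qval x)) = phi A.
Proof. by have [B [r1 [r2 [-> e _]]]] := psiH.2 A x 0; rewrite /phi e !dim_qval. Qed.

Lemma qhom_zero A : psi (qval (0 : fiber Q A)) = qval (0 : fiber R (phi A)).
Proof.
(* With both scalars [0], linearity yields the zero of the target fiber. *)
have [B [r1 [r2 [_ _ /(_ 0 0)]]]] := psiH.2 A 0 0.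
rewrite !scale0r !addr0 => e.
by rewrite /phi e dim_qval.
Qed.

Lemma qhom_dim_iso_additive : zmod_morphism phi.
Proof.
have phiD A B : phi (A + B) = phi A + phi B.
  by rewrite -(dim_qhom (fmul (0 : fiber Q A) (0 : fiber Q B))) /= psiH.1 dimM.
by move=> A B; apply: (addIr (phi B)); rewrite -phiD !subrK.
Qed.

Lemma qhom_dim_iso_bij : bijective phi.
Proof.
(* If [phi A = phi B], the zeros over [A] and [B] have the same image, so they coincide, and so do
   their dimensions. *)
have phi_inj : injective phi.
  move=> A B AB; have := qhom_zero A; rewrite AB -qhom_zero.
  by move/(bij_inj psiB)/(congr1 (@dim _ _ Q)); rewrite !dim_qval.
have phi_surj B : exists A, phi A = B.
  have [r <-] := dim_surj R B; have [g _ gK] := psiB.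
  by exists (dim (g r)); rewrite -(dim_qhom (in_fiber (g r))) gK.
have [g gK] := choice phi_surj.
by exists g => // A; apply: phi_inj; rewrite gK.
Qed.

Lemma qiso_rank : qrank Q = qrank R.
Proof.
pose phiM := GRing.isZmodMorphism.Build _ _ phi qhom_dim_iso_additive.
pose phiA : {additive D -> E} := HB.pack phi phiM.
exact: (@additive_bij_free_rank _ _ phiA qhom_dim_iso_bij).
Qed.

End Isomorphism.

Theorem theorem4p6 (F : fieldType) (D E : dimGroup)
    (Q : quantities F D) (R : quantities F E)
    (hQ : zero_divisor_free Q) (hR : zero_divisor_free R) :
  qisomorphic Q R <-> qrank Q = qrank R.
Proof.
split=> [[psi [psiH psiB]]|/dimGroup_iso[phi [phi' [phiK phiK']]]].
  exact: qiso_rank psiH psiB.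
have [s [sM s0]] := dim_section hQ; have [t [tM t0]] := dim_section hR.
have [psi psiE] := coord_map t s0 phi; have [psi' psiE'] := coord_map s t0 phi'.
exists psi; split; first exact: (coord_map_hom sM tM s0 psiE).
by exists psi'; [exact: coord_map_cancel s0 phiK psiE psiE'
               | exact: coord_map_cancel t0 phiK' psiE' psiE].
Qed.
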